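(* Let $\ell\ge2$, let $\kappa\in\mathbb{N}_+^\ell$ with $\kappa_1+\cdots+\kappa_\ell=n$, and let $A\subseteq\mathcal{U}_\kappa$ (with the convention $0\cdot\ln(1/0)=0$). Then $$\mathbf{E}_{\kappa'\sim\mathbf{lower}(\kappa)}\bigl[\mathrm{vol}(\partial_{\kappa'}A)\bigr]\ \ge\ \mathrm{vol}(A)+\frac1n\cdot\mathrm{vol}(A)\ln(1/\mathrm{vol}(A))\cdot\Bigl(\sum_{i=1}^\ell\log_2(4n/\kappa_i)\Bigr)^{-1}.$$ In particular, at least one lower shadow of $A$ has volume at least the right-hand side. The analogous statement for upper shadows (with $\mathbf{upper}(\kappa)$ in place of $\mathbf{lower}(\kappa)$) also holds.
   Context: For $\mu\in\mathbb{N}^\ell$ with $\sum_i\mu_i=n$, $\mathcal{U}_\mu=\{u\in[\ell]^n : u \text{ has exactly } \mu_i \text{ coordinates equal to } i,\ \forall i\in[\ell]\}$; for $B\subseteq\mathcal{U}_\mu$, $\mathrm{vol}(B)=|B|/|\mathcal{U}_\mu|$ (volume is relative to the containing multislice). Order colors $1\prec2\prec\cdots\prec\ell$, and extend to the coordinatewise partial order on $[\ell]^n$ ($u\prec v$ iff $u\ne v$ and $u_j\preceq v_j$ for all $j$). A histogram $\kappa'$ is a lower neighbor of $\kappa$ if for some colors $c\prec d$: $\kappa'_c=\kappa_c+1$, $\kappa'_d=\kappa_d-1$, and $\kappa'_i=\kappa_i$ for other $i$; it is an upper neighbor if the same holds with $c\succ d$. For $\kappa'$ a lower neighbor, the lower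 shadow of $A$ at $\kappa'$ is $\partial_{\kappa'}A=\{u\in\mathcal{U}_{\kappa'} : u\prec v\text{ for some }v\in A\}$; for $\kappa'$ an upper neighbor, the upper shadow is $\partial_{\kappa'}A=\{u\in\mathcal{U}_{\kappa'} : v\prec u\text{ for some }v\in A\}$. The distribution $\mathbf{lower}(\kappa)$ on lower neighbors: take any $u\in\mathcal{U}_\kappa$; choose $j,j'\in[n]$ independently and uniformly, conditioned on $u_j\ne u_{j'}$; let $c\prec d$ be the two colors $u_j,u_{j'}$; output $\kappa'$ with $\kappa'_c=\kappa_c+1$, $\kappa'_d=\kappa_d-1$, other entries unchanged (the distribution does not depend on $u$). The distribution $\mathbf{upper}(\kappa)$ is the same except that the output has $\kappa'_d=\kappa_d+1$, $\kappa'_c=\kappa_c-1$. *)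

(* Defs.v *)
(* The colors are the elements 0 < 1 < ... < l - 1 of 'I_l. *)
From mathcomp Require Import all_boot all_order all_algebra.
From mathcomp Require Import reals exp.

Set Implicit Arguments.
Unset Strict Implicit.
Unset Printing Implicit Defensive.

Import Order.TTheory GRing.Theory Num.Theory.

Local Open Scope ring_scope.

Notation histogram l := {ffun 'I_l -> nat}.
Notation coloring n l := {ffun 'I_n -> 'I_l}.

Definition multislice (n l : nat) (mu : histogram l) : {set coloring n l} :=
  [set u : coloring n l | [forall i, #|[set j | u j == i]| == mu i]].

Definition vol (R : realType) (n l : nat) (mu : histogram l)
    (B : {set coloring n l}) : R :=
  #|B|%:R / #|multislice n mu|%:R.

Definition prec (n l : nat) (u v : coloring n l) : bool :=
  (u != v) && [forall j, (u j <= v j)%O].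

(* kappa' d = kappa d - 1 is written as kappa d = (kappa' d).+1 to avoid
   truncated subtraction. *)
Definition one_step (l : nat) (kappa kappa' : histogram l) (c d : 'I_l) : Prop :=
  [/\ kappa' c = (kappa c).+1,
      kappa d = (kappa' d).+1
    & forall i, i != c -> i != d -> kappa' i = kappa i].

Definition lower_neighbor (l : nat) (kappa kappa' : histogram l) : Prop :=
  exists c d : 'I_l, (c < d)%O /\ one_step kappa kappa' c d.

Definition upper_neighbor (l : nat) (kappa kappa' : histogram l) : Prop :=
  exists c d : 'I_l, (d < c)%O /\ one_step kappa kappa' c d.

Definition lower_shadow (n l : nat) (kappa' : histogram l)
    (A : {set coloring n l}) : {set coloring n l} :=
  [set u in multislice n kappa' | [exists v in A, prec u v]].

Definition upper_shadow (n l : nat) (kappa' : histogram l)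
    (A : {set coloring n l}) : {set coloring n l} :=
  [set u in multislice n kappa' | [exists v in A, prec v u]].

(* The truncated subtraction is exact as soon as 0 < kappa d, which holds
   whenever the color d occurs in an element of the multislice of kappa. *)
Definition recolor (l : nat) (kappa : histogram l) (d c : 'I_l) : histogram l :=
  [ffun i => (kappa i + (i == c) - (i == d))%N].

Definition bichromatic (n l : nat) (u : coloring n l) : {set 'I_n * 'I_n} :=
  [set p | u p.1 != u p.2].

Definition mean (R : realType) (T : finType) (S : {set T}) (f : T -> R) : R :=
  (\sum_(x in S) f x) / #|S|%:R.

(* E_lower u kappa f is the expectation of f kappa' for kappa' ~ lower(kappa),
   where the sampling of kappa' uses the element u of the multislice of kappa:
   two independent uniform coordinates conditioned on having different colors
   form a uniform element of bichromatic u. *)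
Definition E_lower (R : realType) (n l : nat) (u : coloring n l)
    (kappa : histogram l) (f : histogram l -> R) : R :=
  mean (bichromatic u) (fun p =>
    f (recolor kappa (Order.max (u p.1) (u p.2)) (Order.min (u p.1) (u p.2)))).

Definition E_upper (R : realType) (n l : nat) (u : coloring n l)
    (kappa : histogram l) (f : histogram l -> R) : R :=
  mean (bichromatic u) (fun p =>
    f (recolor kappa (Order.min (u p.1) (u p.2)) (Order.max (u p.1) (u p.2)))).

Definition log2 (R : realType) (x : R) : R := ln x / ln 2.

(* Total division makes this 0 when vol A = 0, as 0 * ln (1 / 0) should be. *)
Definition shadow_bound (R : realType) (n l : nat) (kappa : histogram l)
    (A : {set coloring n l}) : R :=
  vol R kappa A
  + 1 / n%:R * (vol R kappa A * ln (1 / vol R kappa A))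
    * (\sum_(i < l) log2 (4 * n%:R / (kappa i)%:R))^-1.

(* Main.v *)
(* Write U for the multislice of kappa, m_c for kappa c, and call a triple
   (u, j, k) with u in A an exit if transposing the coordinates j, k of u leaves A.

   Entropy: |A| ln (|U| / |A|) <= (1/n) * sum over the exits of 2 + ln (n / m_(u j)).
   This goes by induction on the set D of free coordinates, the others being frozen.
   Revealing the color at a coordinate t, the chain rule splits the entropy into the
   entropies of the fibers {v in A : v t = c}, which are controlled by induction, and
   the divergence of the law of v t from the frequencies m_c / n. If A has a fraction
   nu of its elements with color c at t, then n |A| (nu - m_c / n) of the triples
   (v, t, k) with v t = c must be exits, while nu ln (nu n / m_c) is at most
   (1 + ln (n / m_c)) times the positive part of nu - m_c / n. Averaging over t
   closes the induction, because each exit survives for only n - 2 of the n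
   choices of t.

   Shadows: for colors c <> d, each coloring in the shadow with two prescribed
   coordinates of color c comes from two colorings of U that differ by a
   transposition, so the shadow exceeds A by the number of exits with colors c, d.
   Averaging over pairs of colors, the mean volume of the shadows is at least
   vol A plus the number of exits divided by |U| times the number of bichromatic
   pairs, which is at most n^2. *)
Require Import Defs.
From mathcomp Require Import all_boot all_order all_algebra.
From mathcomp Require Import perm.
From mathcomp Require Import reals exp.
From mathcomp Require Import zify ring lra.

Set Implicit Arguments.
Unset Strict Implicit.
Unset Printing Implicit Defensive.

Import Order.TTheory GRing.Theory Num.Theory.

Local Open Scope ring_scope.

(** * Weights of exits and their one-step inequality *)

Section Logarithms.
Variable R : realType.

Lemma ln_le_sub1 (x : R) : 0 < x -> ln x <= x - 1.
Proof.
move=> x0; have := @le_ln1Dx R (x - 1); rewrite subrKC; apply; lra.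
Qed.

(* The constant 2 absorbs the loss (m - 1) ln (m / (m - 1)) <= 1 that appears in
   weight_step when a coordinate of the color itself is removed. *)
Definition weight (m n : nat) : R := 2 + ln (n%:R / m%:R).

Lemma weight_ge2 m n : (0 < m <= n)%N -> 2 <= weight m n.
Proof.
case/andP=> m0 mn; rewrite lerDl ln_ge0 // ler_pdivlMr ?ltr0n // mul1r ler_nat //.
Qed.

(** Bookkeeping for one exit whose first coordinate has a color of multiplicity [m] among [n] free
    coordinates. It survives the freezing of [n - 2] others, [m - 1] of them of that color; the new
    weights, each divided by [n - 1], plus the price [(1 + ln (n / m)) / n] for revealing its first
    coordinate, must fit in the old weight. *)
Lemma weight_step m n : (0 < m)%N -> (m < n)%N ->
  (n.-1%:R)^-1 * (m.-1%:R * weight m.-1 n.-1 + (n.-1 - m)%:R * weight m n.-1)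
  + n%:R^-1 * (1 + ln (n%:R / m%:R)) <= weight m n.
Proof.
case: n => [|n] // m0; rewrite ltnS /= => mn.
have n0 : (0 < n)%N by apply: leq_trans mn.
have pn : 0 < n%:R :> R by rewrite ltr0n.
have pn1 : 0 < n.+1%:R :> R by rewrite ltr0n.
have pm : 0 < m%:R :> R by rewrite ltr0n.
have Hm : m.-1%:R * weight m.-1 n <= m.-1%:R * weight m n + 1.
  have [->|m1] := posnP m.-1; first by rewrite !mul0r add0r ler01.
  have pm1 : 0 < m.-1%:R :> R by rewrite ltr0n.
  have -> : weight m.-1 n = weight m n + ln (m%:R / m.-1%:R).
    rewrite /weight !ln_div ?posrE //; ring.
  rewrite mulrDr lerD2l.
  apply: le_trans (_ : m.-1%:R * (m%:R / m.-1%:R - 1) <= _).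
    by rewrite ler_pM2l // ln_le_sub1 // divr_gt0.
  have -> : m%:R = m.-1%:R + 1 :> R by rewrite natr1 prednK.
  rewrite le_eqVlt; apply/orP; left; apply/eqP; field; lra.
(* This is [ln x <= x - 1] at [x = n / (n + 1)]. *)
have HL : ln (n%:R / m%:R) <= ln (n.+1%:R / m%:R) - n.+1%:R^-1 :> R.
  have := @ln_le_sub1 (n%:R / n.+1%:R) (divr_gt0 pn pn1).
  have -> : n%:R / n.+1%:R - 1 = - n.+1%:R^-1 :> R.
    have -> : n%:R = n.+1%:R - 1 :> R by rewrite -natr1 addrK.
    by field; rewrite nat1r lt0r_neq0.
  rewrite !ln_div ?posrE //.
  by move: (ln n.+1%:R) (n.+1%:R^-1) => y e ?; lra.
have L0 : 0 <= ln (n.+1%:R / m%:R) :> R.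
  by rewrite ln_ge0 // ler_pdivlMr // mul1r ler_nat; lia.
have Hsum : m.-1%:R * weight m.-1 n + (n - m)%:R * weight m n
    <= n.-1%:R * weight m n + 1.
  have -> : (n - m)%:R = n.-1%:R - m.-1%:R :> R.
    by rewrite -natrB; [congr _%:R | ]; lia.
  lra.
apply: le_trans (_ : n%:R^-1 * (n.-1%:R * weight m n + 1) +
    n.+1%:R^-1 * (1 + ln (n.+1%:R / m%:R)) <= _).
  by rewrite lerD2r ler_pM2l // invr_gt0.
have Hw : n.-1%:R * weight m n <=
   n.-1%:R * (2 + (ln (n.+1%:R / m%:R) - n.+1%:R^-1)).
  by rewrite ler_wpM2l // lerD2l.
rewrite {2}/weight; move: (ln (n.+1%:R / m%:R)) L0 Hw => L L0 Hw.
apply: le_trans (_ : n%:R^-1 * (n.-1%:R * (2 + (L - n.+1%:R^-1)) + 1) +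
    n.+1%:R^-1 * (1 + L) <= _).
  by rewrite lerD2r ler_pM2l ?invr_gt0 // lerD2r.
have En : n.-1%:R = n%:R - 1 :> R by rewrite -subn1 natrB.
rewrite En -[n.+1%:R]natr1.
have n1 : 1 <= n%:R :> R by rewrite ler1n.
rewrite -subr_ge0.
set x : R := n%:R in pn n1 *.
(* The exact slack that remains, nonnegative because [L] is. *)
have -> : 2 + L - (x^-1 * ((x - 1) * (2 + (L - (x + 1)^-1)) + 1) +
   (x + 1)^-1 * (1 + L)) = (x + L) / (x * (x + 1)).
  field; lra.
by apply: divr_ge0; [lra | apply: mulr_ge0; lra].
Qed.
End Logarithms.

(** * Slices with frozen coordinates, and color frequencies under swaps *)

Section Slices.
Variables (T C : finType).
Implicit Types (u v w : {ffun T -> C}) (j k t : T) (D : {set T}) (i : C).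

Definition swap u j k : {ffun T -> C} := [ffun x => u (tperm j k x)].

Lemma swapL u j k : swap u j k j = u k.
Proof. by rewrite ffunE tpermL. Qed.

Lemma swapR u j k : swap u j k k = u j.
Proof. by rewrite ffunE tpermR. Qed.

Lemma swapD u j k t : j != t -> k != t -> swap u j k t = u t.
Proof. by move=> jt kt; rewrite ffunE tpermD. Qed.

Lemma swapK j k : involutive (fun u => swap u j k).
Proof. by move=> u; apply/ffunP=> x; rewrite !ffunE tpermK. Qed.

Lemma swapC u j k : swap u j k = swap u k j.
Proof. by rewrite /swap tpermC. Qed.

Lemma swap_id u j k : u j = u k -> swap u j k = u.
Proof. by move=> ujk; apply/ffunP=> x; rewrite ffunE; case: tpermP => [->|->|]. Qed.

Definition cnt D u i : nat := #|[set x in D | u x == i]|.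

Lemma cnt_swap D u j k i : j \in D -> k \in D -> cnt D (swap u j k) i = cnt D u i.
Proof.
move=> jD kD; rewrite /cnt -(card_preimset [set x in D | u x == i] (@perm_inj _ (tperm j k))).
apply: eq_card => x; rewrite !inE ffunE; congr (_ && _).
by case: tpermP => [->|->|]; rewrite ?jD ?kD.
Qed.

Lemma cntD1 D u t i : t \in D -> cnt D u i = ((u t == i) + cnt (D :\ t) u i)%N.
Proof.
move=> tD; rewrite /cnt (cardsD1 t) inE tD /=; congr (_ + _)%N.
by apply: eq_card => x; rewrite !inE andbA.
Qed.

Lemma cnt_gt0 D u t : t \in D -> (0 < cnt D u (u t))%N.
Proof. by move=> tD; rewrite (cntD1 _ _ tD) eqxx. Qed.

Lemma cnt_le D u i : (cnt D u i <= #|D|)%N.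
Proof. by apply: subset_leq_card; apply/subsetP=> x; rewrite inE => /andP[]. Qed.

Definition slice D u : {set {ffun T -> C}} :=
  [set v : {ffun T -> C} | [forall x, (x \in D) || (v x == u x)]
    && [forall i, cnt D v i == cnt D u i]].

Lemma sliceP D u v :
  reflect ((forall x, x \notin D -> v x = u x) /\ (forall i, cnt D v i = cnt D u i))
    (v \in slice D u).
Proof.
rewrite inE; apply: (iffP andP) => -[H1 H2]; split.
- by move=> x xD; have := forallP H1 x; rewrite (negPf xD) => /eqP.
- by move=> i; apply/eqP/(forallP H2).
- by apply/forallP=> x; have [//|xD] := boolP (x \in D); rewrite H1 /=.
- by apply/forallP=> i; rewrite H2.
Qed.

Lemma slice_refl D u : u \in slice D u.
Proof. by apply/sliceP. Qed.

Lemma slice_cnt D u v i : v \in slice D u -> cnt D v i = cnt D u i.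
Proof. by case/sliceP. Qed.

Lemma slice_swap D u v j k : j \in D -> k \in D ->
  v \in slice D u -> swap v j k \in slice D u.
Proof.
move=> jD kD /sliceP[H1 H2]; apply/sliceP; split=> [x xD|i]; last by rewrite cnt_swap.
by rewrite swapD ?H1 //; apply: contraNneq xD => <-.
Qed.

Lemma slice_set0 u : slice set0 u = [set u].
Proof.
apply/setP=> v; rewrite in_set1; apply/idP/eqP=> [/sliceP[H _]|->]; last exact: slice_refl.
by apply/ffunP=> x; rewrite H ?inE.
Qed.

Lemma slice_fiber D u v t : t \in D -> v \in slice D u ->
  slice (D :\ t) v = [set w in slice D u | w t == v t].
Proof.
move=> tD /sliceP[v1 v2]; apply/setP=> w; rewrite in_set.
apply/idP/andP=> [/sliceP[H1 H2]|[/sliceP[H1 H2] /eqP wt]].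
  have wt : w t = v t by apply: H1; rewrite !inE eqxx.
  split; last exact/eqP.
  apply/sliceP; split=> [x xD|i]; first by rewrite H1 ?v1 // !inE negb_and xD orbT.
  by rewrite -v2 !(cntD1 _ _ tD) wt H2.
apply/sliceP; split=> [x|i].
  by rewrite !inE negb_and negbK => /orP[/eqP->//|xD]; rewrite H1 ?v1.
by have := H2 i; rewrite -v2 !(cntD1 _ _ tD) wt => /addnI.
Qed.

Lemma card_sum (A : {set {ffun T -> C}}) (P : pred {ffun T -> C}) :
  #|[set v in A | P v]| = (\sum_v (v \in A) && P v)%N.
Proof. by rewrite -sum1_card big_mkcond; apply: eq_bigr => v _; rewrite inE; case: (_ && _). Qed.

Lemma sum_card_color D (A : {set {ffun T -> C}}) u i : A \subset slice D u ->
  (\sum_(k in D) #|[set v in A | v k == i]| = #|A| * cnt D u i)%N.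
Proof.
move=> /subsetP sA; under eq_bigr => k _ do rewrite card_sum.
rewrite exchange_big /= -sum_nat_const [RHS]big_mkcond; apply: eq_bigr => v _.
case: ifPn => vA; last by rewrite big1.
rewrite -(slice_cnt _ (sA _ vA)) /cnt -sum1_card big_mkcond [RHS]big_mkcond.
by apply: eq_bigr => k _; rewrite inE; case: (k \in D); case: (v k == i).
Qed.

(** Swapping [t] with any [k] in [D] preserves the slice, so the color [i] is equally frequent at
    all coordinates of [D]. *)
Lemma card_slice_color D u t i : t \in D ->
  (#|[set v in slice D u | v t == i]| * #|D| = #|slice D u| * cnt D u i)%N.
Proof.
move=> tD; rewrite -(sum_card_color i (subxx _)) mulnC -sum_nat_const.
apply: eq_bigr => k kD; rewrite !card_sum (reindex_inj (inv_inj (swapK t k))) /=.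
apply: eq_bigr => v _; rewrite swapL; congr (nat_of_bool (_ && _)).
by apply/idP/idP=> /slice_swap-/(_ t k tD kD) //; rewrite swapK.
Qed.

(** The same swap need not preserve [A]: a coloring of [A] with color [i] at [t] either is sent into
    [A], with color [i] at [k], or is an exit. *)
Lemma card_exit_color D (A : {set {ffun T -> C}}) u t i : A \subset slice D u ->
  (#|[set v in A | v t == i]| * #|D| <=
   #|A| * cnt D u i
   + \sum_(k in D) #|[set v in A | (v t == i) && (swap v t k \notin A)]|)%N.
Proof.
move=> sA; rewrite -(sum_card_color i sA) mulnC -sum_nat_const -big_split /=.
apply: leq_sum => k kD; rewrite !card_sum.
rewrite [X in (_ <= X + _)%N](reindex_inj (inv_inj (swapK t k))) -big_split /=.
apply: leq_sum => v _; rewrite swapR.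
by case: (v \in A); case: (v t == i); case: (swap _ _ _ \in A).
Qed.

(** * The entropy inequality, by induction on the free coordinates *)

Section EntropyInduction.
Variable R : realType.

(** The share of one color in the chain rule: [a], [w] are the sizes of [A] and of the slice, [a'],
    [w'] those of their fibers, [k] the multiplicity of the color, [n] the number of free
    coordinates, [e] the number of exits from the fiber. With [x = a' * n / (a * k)], what must be
    paid for is [a' * ln x], and the excess [a' - a * k / n] is at most [e / n]. *)
Lemma ln_chain (a a' w w' n k e : R) : 0 < a -> 0 < a' -> 0 < w -> 0 < w' -> 0 < k ->
  a' <= a -> k <= n -> w * k <= w' * n -> a' * n <= a * k + e -> 0 <= e ->
  a' * ln (w / a) <= a' * ln (w' / a') + n^-1 * ((1 + ln (n / k)) * e).
Proof.
move=> a0 a'0 w0 w'0 k0 a'a kn wk ae e0.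
have n0 : 0 < n by apply: lt_le_trans kn.
have L0 : 0 <= ln (n / k) by rewrite ln_ge0 // ler_pdivlMr // mul1r.
have x0 : 0 < (a' * n) / (a * k) by rewrite divr_gt0 ?mulr_gt0.
apply: le_trans (_ : a' * ln (w' / a') + a' * ln ((a' * n) / (a * k)) <= _).
  rewrite -mulrDr ler_pM2l // -lnM ?posrE ?divr_gt0 ?mulr_gt0 //.
  rewrite ler_ln ?posrE ?(mulr_gt0, invr_gt0) //.
  have -> : w' / a' * (a' * n / (a * k)) = w' * n / k / a by field; lra.
  by rewrite ler_pM2r ?invr_gt0 // ler_pdivlMr.
rewrite lerD2l; have [x1|x1] := leP ((a' * n) / (a * k)) 1.
  apply: le_trans (_ : 0 <= _); first by rewrite mulr_ge0_le0 // ?ln_le0 // ltW.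
  by rewrite !mulr_ge0 ?invr_ge0 ?addr_ge0 // ltW.
have d0 : 0 <= a' - a * k / n.
  by rewrite subr_ge0 ler_pdivrMr // ltW //; move: x1; rewrite ltr_pdivlMr ?mulr_gt0 // mul1r.
(* Split [a'] into the excess and [a * k / n]. On the excess, [a' <= a] bounds the logarithm by
   [ln (n / k)]; on the rest, [ln x <= x - 1] returns the excess once more, whence the factor
   [1 + ln (n / k)]. *)
have -> : a' * ln (a' * n / (a * k)) = (a' - a * k / n) * ln (a' * n / (a * k))
   + a * k / n * ln (a' * n / (a * k)) by ring.
apply: le_trans (_ : (a' - a * k / n) * ln (n / k)
   + a * k / n * (a' * n / (a * k) - 1) <= _).
  apply: lerD.
    apply: ler_wpM2l => //; rewrite ler_ln ?posrE ?(mulr_gt0, invr_gt0) //.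
    rewrite invfM mulrACA; apply: ler_piMl; first by rewrite divr_ge0 // ltW.
    by rewrite ler_pdivrMr // mul1r.
  apply: ler_wpM2l; last exact: ln_le_sub1.
  by rewrite divr_ge0 ?mulr_ge0 // ltW.
have -> : (a' - a * k / n) * ln (n / k) + a * k / n * (a' * n / (a * k) - 1)
   = (1 + ln (n / k)) * (a' - a * k / n) by field; lra.
rewrite mulrCA ler_wpM2l ?addr_ge0 // [n^-1 * e]mulrC ler_pdivlMr //.
by rewrite mulrBl divfK ?gt_eqF // lerBlDl.
Qed.

Lemma card_color_fibers (A : {set {ffun T -> C}}) t :
  #|A|%:R = \sum_i #|[set v in A | v t == i]|%:R :> R.
Proof.
rewrite -natr_sum -sum1_card (partition_big (fun v : {ffun T -> C} => v t) xpredT) //=.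
by congr _%:R; apply: eq_bigr => i _; rewrite -sum1_card; apply: eq_bigl => v; rewrite inE.
Qed.

Lemma entropy_color D (A : {set {ffun T -> C}}) u t : t \in D -> A \subset slice D u ->
  #|A|%:R * ln (#|slice D u|%:R / #|A|%:R) <=
  \sum_i #|[set v in A | v t == i]|%:R
     * ln (#|[set v in slice D u | v t == i]|%:R / #|[set v in A | v t == i]|%:R)
  + #|D|%:R^-1 * \sum_(k in D) \sum_(v in A | swap v t k \notin A)
       (1 + ln (#|D|%:R / (cnt D v (v t))%:R)) :> R.
Proof.
move=> tD sA; have sA' := subsetP sA.
(* Sort the exits by their color at [t]; multiplicities are constant on the slice. *)
have -> : \sum_(k in D) \sum_(v in A | swap v t k \notin A)
       (1 + ln (#|D|%:R / (cnt D v (v t))%:R)) =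
  \sum_i (1 + ln (#|D|%:R / (cnt D u i)%:R)) *
   (\sum_(k in D) #|[set v in A | (v t == i) && (swap v t k \notin A)]|)%N%:R :> R.
  under [RHS]eq_bigr => i _ do rewrite natr_sum mulr_sumr.
  rewrite [RHS]exchange_big /=; apply: eq_bigr => k kD.
  rewrite (partition_big (fun v : {ffun T -> C} => v t) xpredT) //=.
  apply: eq_bigr => i _; rewrite -[X in _ * X%:R]sum1_card natr_sum mulr_sumr.
  apply: eq_big => [v|v]; first by rewrite !inE -andbA; congr (_ && _); rewrite andbC.
  by case/andP=> /andP[vA _] /eqP <-; rewrite mulr1 (slice_cnt _ (sA' _ vA)).
rewrite [in X in X * _](card_color_fibers A t) mulr_suml mulr_sumr -big_split /=.
apply: ler_sum => i _.
have [->|[v]] := set_0Vmem [set v in A | v t == i].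
  rewrite cards0 !mul0r add0r mulr_ge0 ?invr_ge0 // mulr_ge0 // addr_ge0 //.
  (* For a color absent from [D], the quotient is [0] by total division, and [ln 0 = 0]. *)
  have [->|c0] := posnP (cnt D u i); first by rewrite invr0 mulr0 ln0.
  by rewrite ln_ge0 // ler_pdivlMr ?ltr0n // mul1r ler_nat cnt_le.
rewrite inE => /andP[vA /eqP vi]; have vS := sA' _ vA.
have pos (B : {set {ffun T -> C}}) w : w \in B -> 0 < #|B|%:R :> R.
  by move=> wB; rewrite ltr0n; apply/card_gt0P; exists w.
apply: ln_chain; rewrite -?natrM -?natrD ?ler_nat ?ler0n //.
- exact: pos vA.
- by apply: (pos _ v); rewrite inE vA vi eqxx.
- exact: pos vS.
- by apply: (pos _ v); rewrite inE vS vi eqxx.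
- by rewrite ltr0n -(slice_cnt _ vS) -vi cnt_gt0.
- by apply: subset_leq_card; apply/subsetP=> w; rewrite inE => /andP[].
- exact: cnt_le.
- by rewrite card_slice_color.
- exact: card_exit_color.
Qed.

(** Freezing [t] lowers the multiplicity of the color [v j] exactly when [v t = v j]. With [m] that
    multiplicity, this occurs for [m - 1] values of [t] other than [j]; [#|D| - 1 - m] values
    remain, since [k] has another color and is excluded. *)
Lemma weight_average D v j k : j \in D -> k \in D -> v j != v k ->
  #|D|.-1%:R^-1 * (\sum_(t in D | (t != j) && (t != k)) weight R (cnt (D :\ t) v (v j)) #|D|.-1)
  + #|D|%:R^-1 * (1 + ln (#|D|%:R / (cnt D v (v j))%:R)) <= weight R (cnt D v (v j)) #|D|.
Proof.
move=> jD kD jk; have m0 := cnt_gt0 v jD.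
have mn : (cnt D v (v j) < #|D|)%N.
  apply: proper_card; apply/properP; split; first by apply/subsetP=> x; rewrite inE => /andP[].
  by exists k; rewrite // inE kD eq_sym.
apply: le_trans (weight_step R m0 mn); rewrite le_eqVlt; apply/orP; left; apply/eqP.
congr (_ * _ + _); rewrite (bigID (fun t => v t == v j)) /=.
have E1 : #|[pred t | (t \in D) && ((t != j) && (t != k)) && (v t == v j)]| = (cnt D v (v j)).-1.
  rewrite /cnt (cardsD1 j) inE jD eqxx add1n /=; apply: eq_card => t; rewrite !inE.
  case: (eqVneq t k) => [->|_]; first by rewrite [v k == _]eq_sym (negPf jk) !andbF.
  by case: (t \in D); case: (t == j); case: (v t == v j).
have E2 : #|[pred t | (t \in D) && ((t != j) && (t != k)) && (v t != v j)]|
    = (#|D|.-1 - cnt D v (v j))%N.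
  rewrite -(cardsID [set t in D | v t == v j] D) (setIidPr _); last first.
    by apply/subsetP=> x; rewrite inE => /andP[].
  rewrite -/(cnt D v (v j)) (cardsD1 k (_ :\: _)) !inE kD [v k == _]eq_sym jk /=.
  rewrite addnS /= addKn; apply: eq_card => t; rewrite !inE.
  case: (eqVneq t j) => [->|_]; first by rewrite !eqxx jD /= !andbF.
  by case: (t \in D); case: (t == k); case: (v t == v j).
congr (_ + _).
  rewrite (eq_bigr (fun=> weight R (cnt D v (v j)).-1 #|D|.-1)) => [|t].
    by rewrite sumr_const E1 mulr_natl.
  by case/andP=> /andP[tD _] /eqP tj; rewrite (cntD1 v (v j) tD) tj eqxx.
rewrite (eq_bigr (fun=> weight R (cnt D v (v j)) #|D|.-1)) => [|t].
  by rewrite sumr_const E2 mulr_natl.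
by case/andP=> /andP[tD _] tj; rewrite (cntD1 v (v j) tD) (negPf tj).
Qed.

(** A swap of two coordinates other than [t] keeps the color at [t], so it leaves a fiber exactly
    when it leaves [A], and the induction hypotheses of the fibers add up. *)
Lemma entropy_fibers D (A : {set {ffun T -> C}}) u t :
    (forall u' (B : {set {ffun T -> C}}), B \subset slice (D :\ t) u' ->
      #|B|%:R * ln (#|slice (D :\ t) u'|%:R / #|B|%:R) <=
      #|D|.-1%:R^-1 * \sum_(j in D :\ t) \sum_(k in D :\ t)
         \sum_(v in B | swap v j k \notin B) weight R (cnt (D :\ t) v (v j)) #|D|.-1) ->
  t \in D -> A \subset slice D u ->
  \sum_i #|[set v in A | v t == i]|%:R
     * ln (#|[set v in slice D u | v t == i]|%:R / #|[set v in A | v t == i]|%:R)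
  <= #|D|.-1%:R^-1 * \sum_(j in D :\ t) \sum_(k in D :\ t)
         \sum_(v in A | swap v j k \notin A) weight R (cnt (D :\ t) v (v j)) #|D|.-1.
Proof.
move=> IH tD sA.
have -> : \sum_(j in D :\ t) \sum_(k in D :\ t)
         \sum_(v in A | swap v j k \notin A) weight R (cnt (D :\ t) v (v j)) #|D|.-1
  = \sum_i \sum_(j in D :\ t) \sum_(k in D :\ t)
         \sum_(v in [set v in A | v t == i] | swap v j k \notin [set v in A | v t == i])
            weight R (cnt (D :\ t) v (v j)) #|D|.-1.
  rewrite [RHS]exchange_big /=; apply: eq_bigr => j; rewrite !inE => /andP[jt jD].
  rewrite [RHS]exchange_big /=; apply: eq_bigr => k; rewrite !inE => /andP[kt kD].
  rewrite (partition_big (fun v : {ffun T -> C} => v t) xpredT) //=.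
  apply: eq_bigr => i _; apply: eq_bigl => v; rewrite !inE swapD //.
  by case: (v \in A); case: (v t == i); case: (swap v j k \in A).
rewrite mulr_sumr; apply: ler_sum => i _.
have [->|[v]] := set_0Vmem [set v in A | v t == i].
  rewrite cards0 mul0r mulr_ge0 ?invr_ge0 //; apply: sumr_ge0 => j _; apply: sumr_ge0 => k _.
  by rewrite big1 // => v; rewrite inE.
rewrite inE => /andP[vA /eqP <-].
rewrite -(slice_fiber tD (subsetP sA _ vA)); apply: IH.
rewrite (slice_fiber tD (subsetP sA _ vA)); apply/subsetP=> w.
by rewrite !inE => /andP[/(subsetP sA)]; rewrite inE => -> ->.
Qed.

Lemma slice_entropy D (A : {set {ffun T -> C}}) u : A \subset slice D u ->
  #|A|%:R * ln (#|slice D u|%:R / #|A|%:R) <=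
  #|D|%:R^-1 * \sum_(j in D) \sum_(k in D) \sum_(v in A | swap v j k \notin A)
     weight R (cnt D v (v j)) #|D|.
Proof.
move cD : #|D| => n; elim: n => [|n IH] in D A u cD *.
  have -> : D = set0 by apply/eqP; rewrite -cards_eq0 cD.
  rewrite slice_set0 cards1 invr0 mul0r subset1 => /orP[] /eqP->.
    by rewrite cards1 divr1 ln1 mulr0.
  by rewrite cards0 mul0r.
move=> sA; have n0 : 0 < n.+1%:R :> R by rewrite ltr0n.
(* After multiplication by [#|D|], the left side is a sum over the revealed coordinate [t]. *)
rewrite -(ler_pM2l n0) mulVKf ?gt_eqF // [n.+1%:R * _]mulr_natl -cD -sumr_const.
have step t : t \in D -> #|A|%:R * ln (#|slice D u|%:R / #|A|%:R) <=
    #|D|.-1%:R^-1 * (\sum_(j in D :\ t) \sum_(k in D :\ t)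
      \sum_(v in A | swap v j k \notin A) weight R (cnt (D :\ t) v (v j)) #|D|.-1)
    + #|D|%:R^-1 * \sum_(k in D) \sum_(v in A | swap v t k \notin A)
        (1 + ln (#|D|%:R / (cnt D v (v t))%:R)) :> R.
  move=> tD; apply: le_trans (entropy_color tD sA) _; rewrite lerD2r.
  apply: entropy_fibers => // u' B sB; rewrite cD /=; apply: IH => //.
  by move: cD; rewrite (cardsD1 t) tD => -[].
apply: le_trans (ler_sum _ step) _.
rewrite big_split /= -!mulr_sumr.
(* Bring [t] innermost, so that all contributions of an exit [(v, j, k)] are gathered; in the second
   sum the revealed coordinate is [j] itself. *)
rewrite (exchange_big_dep (mem D)) /=; last by move=> t j _; rewrite !inE => /andP[].
rewrite !mulr_sumr -big_split /=; apply: ler_sum => j jD.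
rewrite (exchange_big_dep (mem D)) /=; last by move=> t k _; rewrite !inE => /andP[].
rewrite !mulr_sumr -big_split /=; apply: ler_sum => k kD.
rewrite exchange_big /= !mulr_sumr -big_split /=; apply: ler_sum => v /andP[vA vjk].
have jk : v j != v k by apply: contraNneq vjk => /swap_id ->.
apply: le_trans (weight_average jD kD jk); rewrite lerD2r.
rewrite le_eqVlt; apply/orP; left; apply/eqP; congr (_ * _).
apply: eq_bigl => t; rewrite !inE jD kD !andbT -andbA; congr (_ && _).
by rewrite [j == t]eq_sym [k == t]eq_sym.
Qed.

End EntropyInduction.
End Slices.

(** * Counting the colorings of a shadow by means of exits *)

Section Shadows.
Variables (R : realType) (n l : nat).
Implicit Types (u v w : coloring n l) (j k : 'I_n) (c d i : 'I_l) (kappa : histogram l).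
Implicit Types (A W : {set coloring n l}).

Lemma multisliceP kappa u :
  reflect (forall i, cnt setT u i = kappa i) (u \in multislice n kappa).
Proof.
have E i : cnt setT u i = #|[set j | u j == i]|.
  by apply: eq_card => j; rewrite !inE.
rewrite inE; apply: (iffP forallP) => H i; first by rewrite E; apply/eqP/H.
by rewrite -E H.
Qed.

Lemma multislice_slice kappa u : u \in multislice n kappa ->
  slice setT u = multislice n kappa.
Proof.
move=> /multisliceP uk; apply/setP=> v; apply/sliceP/multisliceP => [[_ H] i|H].
  by rewrite H uk.
by split=> [x|i]; rewrite ?inE // H uk.
Qed.

Lemma sum_card_color_multislice kappa i W : W \subset multislice n kappa ->
  (\sum_k #|[set v in W | v k == i]| = #|W| * kappa i)%N.
Proof.
have [->|[u uW]] := set_0Vmem W.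
  by rewrite cards0 mul0n big1 // => k _; apply: eq_card0 => v; rewrite !inE.
move=> sW; have uk := subsetP sW _ uW.
rewrite -(multisliceP _ _ uk) -(sum_card_color (D := setT)) ?(multislice_slice uk) //.
by apply: eq_bigl => k; rewrite inE.
Qed.

Definition paint u k c : coloring n l := [ffun x => if x == k then c else u x].

Lemma paint_inj u v k c d : u k = d -> v k = d -> paint u k c = paint v k c -> u = v.
Proof.
move=> ukd vkd /ffunP E; apply/ffunP=> x; have := E x; rewrite !ffunE.
by case: eqP => [->|//]; rewrite ukd vkd.
Qed.

Lemma paint_multislice kappa u k c :
  u \in multislice n kappa -> u k != c ->
  paint u k c \in multislice n (recolor kappa (u k) c).
Proof.
move=> /multisliceP uk ukc; apply/multisliceP=> i; rewrite ffunE -uk.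
rewrite !(cntD1 _ _ (in_setT k)) ffunE eqxx.
have -> : cnt (setT :\ k) (paint u k c) i = cnt (setT :\ k) u i.
  by apply: eq_card => x; rewrite !inE ffunE; case: (x == k).
by rewrite [c == i]eq_sym [u k == i]eq_sym -addnA addKn addnC.
Qed.

Lemma recolorK kappa c d : (0 < kappa d)%N -> c != d ->
  recolor (recolor kappa d c) c d = kappa.
Proof.
move=> k0 cd; apply/ffunP=> i; rewrite !ffunE.
have [->|_] := eqVneq i c; first by rewrite ?eqxx (negPf cd) /=; lia.
by case: (eqVneq i d) => [->|_] /=; lia.
Qed.

(** Painting [k] back from [c] to [d] is injective on the colorings with color [c] at [k]; sum over
    [k]. *)
Lemma card_multislice_recolor kappa c d : (0 < kappa d)%N -> c != d ->
  (#|multislice n (recolor kappa d c)| * (kappa c).+1 <= #|multislice n kappa| * kappa d)%N.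
Proof.
move=> k0 cd.
have -> : (kappa c).+1 = recolor kappa d c c by rewrite ffunE eqxx (negPf cd); lia.
rewrite -!sum_card_color_multislice //; apply: leq_sum => k _.
rewrite -(card_in_imset (f := fun v => paint v k d)); last first.
  by move=> v w; rewrite !inE => /andP[_ /eqP vk] /andP[_ /eqP wk]; apply: paint_inj vk wk.
apply: subset_leq_card; apply/subsetP=> _ /imsetP[v + ->].
rewrite inE => /andP[vU /eqP vk]; rewrite inE ffunE eqxx eqxx andbT.
by have := paint_multislice vU (_ : v k != d); rewrite vk recolorK //; apply.
Qed.

Definition exits A c d : nat :=
  (\sum_j \sum_k #|[set u in A | [&& u j == c, u k == d & swap u j k \notin A]]|)%N.

Lemma exitsC A c d : exits A c d = exits A d c.
Proof.
rewrite /exits exchange_big; apply: eq_bigr => j _; apply: eq_bigr => k _.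
by apply: eq_card => u; rewrite !inE swapC; congr (_ && _); rewrite andbCA.
Qed.

Lemma sum_card_two_colors A kappa c d : A \subset multislice n kappa -> c != d ->
  (\sum_j \sum_k #|[set u in A | (u j == c) && (u k == d)]| = #|A| * (kappa c * kappa d))%N.
Proof.
move=> sA cd; rewrite mulnA -sum_card_color_multislice // big_distrl; apply: eq_bigr => j _ /=.
rewrite -sum_card_color_multislice; last first.
  by apply: subset_trans sA; apply/subsetP=> u; rewrite inE => /andP[].
by apply: eq_bigr => k _; apply: eq_card => u; rewrite !inE andbA.
Qed.

Lemma sum_card_one_color W kappa c : W \subset multislice n kappa ->
  (\sum_j \sum_(k | k != j) #|[set v in W | (v j == c) && (v k == c)]|
   = #|W| * (kappa c * (kappa c).-1))%N.
Proof.
move=> sW; rewrite mulnA -sum_card_color_multislice // big_distrl; apply: eq_bigr => j _ /=.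
have sWj : [set v in W | v j == c] \subset multislice n kappa.
  by apply: subset_trans sW; apply/subsetP=> u; rewrite inE => /andP[].
(* The full sum over [k] has the extra term [k = j], which counts every coloring with color [c] at
   [j]; hence the predecessor. *)
rewrite -subn1 mulnBr muln1 -(sum_card_color_multislice _ sWj) [in RHS](bigD1 j) //=.
have -> : [set v in [set v in W | v j == c] | v j == c] = [set v in W | v j == c].
  by apply/setP=> v; rewrite !inE -andbA andbb.
by rewrite addKn; apply: eq_bigr => k _; apply: eq_card => u; rewrite !inE andbA.
Qed.

(* A coloring w with w j = w k = c is painted from two colorings by turning k
   into c: one with the colors c, d at j, k, and its swap. It is in the shadow as
   soon as one of them is in A, so that every exit from A counts once more. *)
Lemma shadow_count A W kappa c d : A \subset multislice n kappa -> c != d ->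
    W \subset multislice n (recolor kappa d c) ->
    (forall u k, u \in A -> u k = d -> paint u k c \in W) ->
  (#|A| * (kappa c * kappa d) + exits A d c <= #|W| * ((kappa c).+1 * kappa c))%N.
Proof.
move=> sA cd sW AW.
have E : recolor kappa d c c = (kappa c).+1 by rewrite ffunE eqxx (negPf cd); lia.
rewrite -[X in (_ <= _ * (_ * X))%N]/((kappa c).+1.-1) -E -sum_card_one_color //.
rewrite -(sum_card_two_colors sA cd) -big_split; apply: leq_sum => j _ /=.
rewrite -big_split (bigD1 j) //= [X in (X + _)%N](_ : _ = 0)%N ?add0n; last first.
  apply/eqP; rewrite addn_eq0 !cards_eq0 -!subset0; apply/andP; split.
    apply/subsetP=> u; rewrite !inE => /and3P[_ /eqP-> dc].
    by rewrite (negPf cd) in dc.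
  apply/subsetP=> u; rewrite !inE => /and4P[_ /eqP-> dc _].
  by rewrite eq_sym (negPf cd) in dc.
apply: leq_sum => k kj.
(* Replace each exit by its swap, which lies outside [A]. The two sets then carry the same colors at
   [j], [k] and are disjoint, so painting [k] is injective on their union. *)
rewrite [X in (_ + X <= _)%N](_ : _ =
    #|[set u : coloring n l | [&& u j == c, u k == d, u \notin A & swap u j k \in A]]|); last first.
  rewrite -[LHS](card_imset _ (inv_inj (swapK j k))); apply: eq_card => u.
  apply/imsetP/idP=> [[w + ->]|].
    by rewrite !inE swapL swapR swapK => /and4P[-> -> -> ->].
  rewrite inE => /and4P[uj uk uA sA']; exists (swap u j k); last by rewrite swapK.
  by rewrite inE sA' swapL swapR uj uk swapK uA.
rewrite -cardsUI [X in (_ + X <= _)%N](_ : _ = 0)%N ?addn0; last first.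
  apply/eqP; rewrite cards_eq0 -subset0; apply/subsetP=> u; rewrite !inE.
  by case: (u \in A); rewrite ?andbF.
rewrite -(card_in_imset (f := fun v => paint v k c)); last first.
  move=> u v; rewrite !inE => Hu Hv; apply: (@paint_inj _ _ _ _ d).
    by case/orP: Hu => [/and3P[_ _ /eqP]|/and4P[_ /eqP]].
  by case/orP: Hv => [/and3P[_ _ /eqP]|/and4P[_ /eqP]].
apply: subset_leq_card; apply/subsetP=> _ /imsetP[u + ->].
rewrite !inE !ffunE eqxx eqxx andbT [j == k]eq_sym (negPf kj) => /orP[|].
  by case/and3P=> uA -> /eqP uk; rewrite AW.
case/and4P=> /eqP uj /eqP uk _ sA'; rewrite uj eqxx andbT.
(* Here [u] is not in [A] but its swap is, and painting [j] in the swap gives the same coloring. *)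
rewrite (_ : paint u k c = paint (swap u j k) j c); first by rewrite AW // swapL.
apply/ffunP=> x; rewrite !ffunE.
have [->|xk] := eqVneq x k; first by rewrite (negPf kj) tpermR uj.
by have [->//|xj] := eqVneq x j; rewrite tpermD // eq_sym.
Qed.

(** Turns cardinalities into volumes through [card_multislice_recolor]. The factor
    [kappa c * kappa d], the number of coordinate pairs colored [c], [d], is kept as the weight for
    the averaging. *)
Lemma shadow_vol A W kappa c d : A \subset multislice n kappa -> (0 < kappa d)%N ->
    c != d -> W \subset multislice n (recolor kappa d c) ->
    (forall u k, u \in A -> u k = d -> paint u k c \in W) ->
  (#|A| * (kappa c * kappa d) + exits A d c)%N%:R
  <= (kappa c * kappa d * #|multislice n kappa|)%N%:R * vol R (recolor kappa d c) W.
Proof.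
move=> sA k0 cd sW AW; have := shadow_count sA cd sW AW; rewrite -(ler_nat R).
move=> /le_trans; apply.
set U' := multislice n (recolor kappa d c).
have -> : (#|W| * ((kappa c).+1 * kappa c))%N%:R
   = (kappa c * (#|U'| * (kappa c).+1))%N%:R * vol R (recolor kappa d c) W.
  (* If [U'] is empty then so is [W], and both sides are [0]. *)
  rewrite /vol -/U'; have [U0|U0] := posnP #|U'|; last first.
    by rewrite !natrM; field; rewrite pnatr_eq0 -lt0n.
  have -> : #|W| = 0%N by apply/eqP; rewrite -leqn0 -U0 subset_leq_card.
  by rewrite !mul0r mulr0.
apply: ler_wpM2r; first by rewrite divr_ge0.
rewrite ler_nat -mulnA leq_mul2l; apply/orP; right.
by rewrite [(kappa d * _)%N]mulnC card_multislice_recolor.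
Qed.

(** * Averaging over pairs of colors *)

Lemma sum_bichromatic kappa u (g : 'I_l -> 'I_l -> R) : u \in multislice n kappa ->
  \sum_(p in bichromatic u) g (u p.1) (u p.2)
  = \sum_(q | q.1 != q.2) (kappa q.1 * kappa q.2)%N%:R * g q.1 q.2.
Proof.
move=> /multisliceP uk.
(* Group the coordinate pairs by their colors: [kappa c * kappa d] of them have colors [c], [d],
   whatever [u] is. *)
rewrite (partition_big (fun p => (u p.1, u p.2)) (fun q => q.1 != q.2)) /=; last first.
  by move=> p; rewrite inE.
apply: eq_bigr => -[c d] /= cd.
rewrite (eq_bigr (fun=> g c d)) => [|[j k] /= /andP[_ /eqP[-> ->]] //].
rewrite sumr_const mulr_natl; congr (_ *+ _).
rewrite -!uk -cardsX; apply: eq_card => -[j k]; rewrite !inE unfold_in /= inE /= xpair_eqE.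
rewrite andb_idl // => /andP[/eqP-> /eqP->] //.
Qed.

(** A swap of equal colors is the identity, so the pairs of distinct colors account for all
    exits. *)
Lemma sum_exits A :
  (\sum_(q | q.1 != q.2) exits A q.1 q.2 = \sum_j \sum_k #|[set u in A | swap u j k \notin A]|)%N.
Proof.
rewrite exchange_big; apply: eq_bigr => j _; rewrite exchange_big; apply: eq_bigr => k _ /=.
rewrite -[RHS]sum1_card (partition_big (fun u : coloring n l => (u j, u k)) (fun q => q.1 != q.2)) /=.
  apply: eq_bigr => -[c d] _; rewrite -sum1_card; apply: eq_bigl => u /=.
  by rewrite !inE xpair_eqE; case: (u \in A); case: (u j == c); case: (u k == d);
    rewrite ?andbF ?andbT.
by move=> u; rewrite inE => /andP[uA]; apply: contraNneq => /swap_id ->.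
Qed.

Lemma ln2_le1 : ln 2 <= 1 :> R.
Proof. by apply: le_trans (ln_le_sub1 _) _; lra. Qed.

(** The factor 4 yields the constant 2 of the weight, and passing to base 2 only enlarges the
    logarithm since [ln 2 <= 1]. *)
Lemma weight_le_log2 kappa i : (0 < kappa i <= n)%N ->
  weight R (kappa i) n <= log2 (4 * n%:R / (kappa i)%:R).
Proof.
case/andP=> k0 kn.
have ln20 : 0 < ln 2 :> R by rewrite ln_gt0 // ltr1n.
have pk : 0 < (kappa i)%:R :> R by rewrite ltr0n.
have pn : 0 < n%:R :> R by rewrite ltr0n (leq_trans k0).
have L0 : 0 <= ln (n%:R / (kappa i)%:R) :> R.
  by rewrite ln_ge0 // ler_pdivlMr // mul1r ler_nat.
have -> : log2 (4 * n%:R / (kappa i)%:R) = 2 + ln (n%:R / (kappa i)%:R) / ln 2 :> R.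
  rewrite /log2 -mulrA (_ : 4 = 2 ^+ 2); last by rewrite -natrX.
  rewrite [ln (_ * _)]lnM ?posrE ?exprn_gt0 ?divr_gt0 // lnXn // -[ln 2 *+ 2]mulr_natl mulrDl.
  by rewrite mulfK ?gt_eqF.
by rewrite /weight lerD2l ler_pdivlMr // ler_piMr // ln2_le1.
Qed.

Lemma exits_lower_bound kappa A : (forall i, (0 < kappa i)%N) -> (\sum_i kappa i)%N = n ->
  A \subset multislice n kappa ->
  n%:R * (#|A|%:R * ln (#|multislice n kappa|%:R / #|A|%:R))
    / \sum_(i < l) log2 (4 * n%:R / (kappa i)%:R)
  <= (\sum_j \sum_k #|[set u in A | swap u j k \notin A]|)%N%:R :> R.
Proof.
move=> k0 kn sA; have kle i : (kappa i <= n)%N by rewrite -kn (bigD1 i) //= leq_addr.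
have [->|[u uA]] := set_0Vmem A; first by rewrite cards0 !mul0r mulr0 mul0r.
have uk := subsetP sA _ uA.
set S := \sum_(i < l) _.
(* All terms of [S] are nonnegative, so each weight, bounded by its own term, is bounded by [S]. *)
have wS i : weight R (kappa i) n <= S.
  apply: le_trans (weight_le_log2 _) _; first by rewrite k0 kle.
  rewrite /S (bigD1 i) //= lerDl; apply: sumr_ge0 => i' _.
  apply: le_trans (weight_le_log2 _); last by rewrite k0 kle.
  by apply: le_trans (weight_ge2 _ _); rewrite ?k0 ?kle.
have [n0|n0] := posnP n; first by rewrite [X in X%:R * (_ * _)]n0 !mul0r.
have S0 : 0 < S.
  have [i _] : exists i : 'I_l, true by exists (u (Ordinal n0)).
  apply: lt_le_trans (wS i); apply: lt_le_trans (weight_ge2 R _); rewrite ?k0 ?kle //.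
have := @slice_entropy _ _ R setT A u; rewrite (multislice_slice uk) => /(_ sA).
rewrite cardsT card_ord -(ler_pM2l (_ : 0 < n%:R)) ?ltr0n //.
rewrite mulVKf ?pnatr_eq0 -?lt0n // => /le_trans H.
rewrite ler_pdivrMr //; apply: H.
rewrite natr_sum mulr_suml (eq_bigl xpredT) => [|j]; last by rewrite inE.
apply: ler_sum => j _; rewrite natr_sum mulr_suml (eq_bigl xpredT) => [|k]; last by rewrite inE.
apply: ler_sum => k _; rewrite mulr_natl -sumr_const.
rewrite [leRHS](eq_bigl (fun v => (v \in A) && (swap v j k \notin A))) => [|v].
  by apply: ler_sum => v /andP[/(subsetP sA)/multisliceP-> _].
by rewrite inE.
Qed.

Lemma bichromatic_neq0 kappa u : (2 <= l)%N -> (forall i, (0 < kappa i)%N) ->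
  u \in multislice n kappa -> exists p, p \in bichromatic u.
Proof.
move=> hl k0 /multisliceP uk.
have ex i : exists j, u j = i.
  have := k0 i; rewrite -uk => /card_gt0P[j]; rewrite !inE => /eqP <-; by exists j.
have [[j uj] [k ukd]] := (ex (Ordinal (ltnW hl)), ex (Ordinal hl)).
by exists (j, k); rewrite inE /= uj ukd.
Qed.

(** Leaving [g] abstract lets lower and upper shadows share the averaging: the hypothesis is summed
    over ordered pairs of distinct colors, then combined with the lower bound on the exits. *)
Lemma shadow_bound_mean kappa A u (g : 'I_l -> 'I_l -> R) : (2 <= l)%N ->
    (forall i, (0 < kappa i)%N) -> (\sum_i kappa i)%N = n ->
    A \subset multislice n kappa -> u \in multislice n kappa ->
    (forall c d, c != d -> (#|A| * (kappa c * kappa d) + exits A c d)%N%:R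
       <= (kappa c * kappa d * #|multislice n kappa|)%N%:R * g c d) ->
  shadow_bound R kappa A <= mean (bichromatic u) (fun p => g (u p.1) (u p.2)).
Proof.
move=> hl k0 kn sA uU Hg; have [p pB] := bichromatic_neq0 hl k0 uU.
have kle i : (kappa i <= n)%N by rewrite -kn (bigD1 i) //= leq_addr.
have n0 : 0 < n%:R :> R by rewrite ltr0n; case: p pB => -[j jn] _ _; apply: leq_trans jn.
have N0 : 0 < #|bichromatic u|%:R :> R by rewrite ltr0n; apply/card_gt0P; exists p.
have M0 : 0 < #|multislice n kappa|%:R :> R by rewrite ltr0n; apply/card_gt0P; exists u.
have HN : #|bichromatic u|%:R = \sum_(q : 'I_l * 'I_l | q.1 != q.2) (kappa q.1 * kappa q.2)%N%:R :> R.
  have := sum_bichromatic (fun _ _ => 1) uU; rewrite sumr_const => ->.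
  by apply: eq_bigr => q _; rewrite mulr1.
have Nn : #|bichromatic u|%:R <= n%:R * n%:R :> R.
  rewrite -natrM ler_nat; apply: leq_trans (max_card _) _.
  by rewrite card_prod card_ord.
rewrite /mean (sum_bichromatic _ uU) ler_pdivlMr // -(ler_pM2l M0).
have HX : #|A|%:R * #|bichromatic u|%:R
      + (\sum_j \sum_k #|[set u in A | swap u j k \notin A]|)%N%:R
    <= #|multislice n kappa|%:R
        * \sum_(q | q.1 != q.2) (kappa q.1 * kappa q.2)%N%:R * g q.1 q.2.
  rewrite -sum_exits HN !mulr_sumr natr_sum -big_split; apply: ler_sum => -[c d] /= cd.
  by rewrite -natrM -natrD mulrA -natrM [(#|multislice _ _| * _)%N]mulnC Hg.
apply: le_trans HX.
have := exits_lower_bound k0 kn sA; rewrite /shadow_bound /vol.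
set S := \sum_(i < l) _ => HX.
have S0 : 0 <= S.
  apply: sumr_ge0 => i _; apply: le_trans (weight_le_log2 _); last by rewrite k0 kle.
  by apply: le_trans (weight_ge2 R _); rewrite ?k0 ?kle.
rewrite mul1r invf_div mul1r.
have Y0 : 0 <= #|A|%:R * ln (#|multislice n kappa|%:R / #|A|%:R) :> R.
  have [->|A0] := posnP #|A|; first by rewrite mul0r.
  rewrite mulr_ge0 // ln_ge0 // ler_pdivlMr ?ltr0n // mul1r ler_nat.
  exact: subset_leq_card.
have -> : #|multislice n kappa|%:R * ((#|A|%:R / #|multislice n kappa|%:R +
     n%:R^-1 * (#|A|%:R / #|multislice n kappa|%:R
       * ln (#|multislice n kappa|%:R / #|A|%:R)) * S^-1) * #|bichromatic u|%:R)
  = #|A|%:R * #|bichromatic u|%:R + #|bichromatic u|%:R *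
     (n%:R^-1 * (#|A|%:R * ln (#|multislice n kappa|%:R / #|A|%:R)) / S) :> R.
  move: (S^-1) (ln _) => s y; by field; rewrite !gt_eqF.
rewrite lerD2l; apply: le_trans HX.
(* Replacing the number of bichromatic pairs by [n * n] is allowed because its cofactor is
   nonnegative, by [Y0] and [S0]. *)
apply: le_trans (_ : n%:R * n%:R * (n%:R^-1 *
   (#|A|%:R * ln (#|multislice n kappa|%:R / #|A|%:R)) / S) <= _).
  by apply: ler_wpM2r => //; rewrite mulr_ge0 ?invr_ge0 // mulr_ge0 ?invr_ge0.
by rewrite !mulrA mulfK ?gt_eqF.
Qed.

(** * Specialization to lower and upper shadows, and choice of a neighbor *)

Lemma mean_le_exists (X : finType) (B : {set X}) (f : X -> R) (b : R) :
  (exists x, x \in B) -> b <= mean B f -> exists2 x, x \in B & b <= f x.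
Proof.
move=> [x xB] bm; have [y /andP[yB by_]|none] := pickP (fun y => (y \in B) && (b <= f y)).
  by exists y.
have B0 : 0 < #|B|%:R :> R by rewrite ltr0n; apply/card_gt0P; exists x.
move: bm; rewrite /mean ler_pdivlMr // mulr_natr -sumr_const leNgt => /negP[].
apply: ltr_sum => [|y yB]; first by apply/hasP; exists x; rewrite ?mem_index_enum.
by rewrite ltNge; have := none y; rewrite yB => /= ->.
Qed.

Lemma one_step_recolor kappa c d : (0 < kappa d)%N -> c != d ->
  one_step kappa (recolor kappa d c) c d.
Proof.
move=> k0 cd; split=> [||i ic id]; rewrite !ffunE.
- by rewrite eqxx (negPf cd) subn0 addn1.
- by rewrite eqxx [d == c]eq_sym (negPf cd); lia.
- by rewrite (negPf ic) (negPf id) addn0 subn0.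
Qed.

(** Painting a coordinate from [d] to the smaller color [c] goes strictly down, so the lower shadow
    contains all the colorings that [shadow_vol] asks for. *)
Lemma lower_shadow_vol A kappa c d : A \subset multislice n kappa ->
    (forall i, (0 < kappa i)%N) -> (c < d)%O ->
  (#|A| * (kappa c * kappa d) + exits A c d)%N%:R
  <= (kappa c * kappa d * #|multislice n kappa|)%N%:R
     * vol R (recolor kappa d c) (lower_shadow (recolor kappa d c) A).
Proof.
move=> sA k0 cd; have ncd : c != d by rewrite lt_eqF.
rewrite exitsC; apply: shadow_vol => // [|u k uA uk].
  by apply/subsetP=> v; rewrite inE => /andP[].
rewrite inE -{1}uk paint_multislice ?(subsetP sA) // ?uk 1?eq_sym //=.
apply/existsP; exists u; rewrite uA /=; apply/andP; split.
  by apply: contraNneq ncd => /ffunP/(_ k); rewrite ffunE eqxx uk => ->.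
by apply/forallP=> x; rewrite ffunE; case: eqP => [->|//]; rewrite uk ltW.
Qed.

Lemma upper_shadow_vol A kappa c d : A \subset multislice n kappa ->
    (forall i, (0 < kappa i)%N) -> (d < c)%O ->
  (#|A| * (kappa c * kappa d) + exits A c d)%N%:R
  <= (kappa c * kappa d * #|multislice n kappa|)%N%:R
     * vol R (recolor kappa d c) (upper_shadow (recolor kappa d c) A).
Proof.
move=> sA k0 dc; have ncd : c != d by rewrite gt_eqF.
rewrite exitsC; apply: shadow_vol => // [|u k uA uk].
  by apply/subsetP=> v; rewrite inE => /andP[].
rewrite inE -{1}uk paint_multislice ?(subsetP sA) // ?uk 1?eq_sym //=.
apply/existsP; exists u; rewrite uA /=; apply/andP; split.
  by apply: contraNneq ncd => /ffunP/(_ k); rewrite ffunE eqxx uk => ->.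
by apply/forallP=> x; rewrite ffunE; case: eqP => [->|//]; rewrite uk ltW.
Qed.

Lemma shadow_bound_E_lower kappa A u : (2 <= l)%N ->
    (forall i, (0 < kappa i)%N) -> (\sum_i kappa i)%N = n ->
    A \subset multislice n kappa -> u \in multislice n kappa ->
  shadow_bound R kappa A <=
    E_lower u kappa (fun kappa' => vol R kappa' (lower_shadow kappa' A)).
Proof.
move=> hl k0 kn sA uU.
(* With [max] and [min], [g] is symmetric; when [d < c] the roles are exchanged through [exitsC]. *)
apply: (shadow_bound_mean (g := fun c d => let k := recolor kappa (Order.max c d) (Order.min c d)
  in vol R k (lower_shadow k A))) => // c d.
rewrite neq_lt => /orP[cd|dc] /=.
  by rewrite (max_r (ltW cd)) (min_l (ltW cd)); apply: lower_shadow_vol.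
rewrite (max_l (ltW dc)) (min_r (ltW dc)) exitsC [(kappa c * _)%N]mulnC.
exact: lower_shadow_vol.
Qed.

Lemma shadow_bound_E_upper kappa A u : (2 <= l)%N ->
    (forall i, (0 < kappa i)%N) -> (\sum_i kappa i)%N = n ->
    A \subset multislice n kappa -> u \in multislice n kappa ->
  shadow_bound R kappa A <=
    E_upper u kappa (fun kappa' => vol R kappa' (upper_shadow kappa' A)).
Proof.
move=> hl k0 kn sA uU.
apply: (shadow_bound_mean (g := fun c d => let k := recolor kappa (Order.min c d) (Order.max c d)
  in vol R k (upper_shadow k A))) => // c d.
rewrite neq_lt => /orP[cd|dc] /=; last first.
  by rewrite (max_l (ltW dc)) (min_r (ltW dc)); apply: upper_shadow_vol.
rewrite (max_r (ltW cd)) (min_l (ltW cd)) exitsC [(kappa c * _)%N]mulnC.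
exact: upper_shadow_vol.
Qed.

Lemma shadow_bound_set0 kappa : shadow_bound R kappa (set0 : {set coloring n l}) = 0.
Proof. by rewrite /shadow_bound /vol cards0 !mul0r mulr0 mul0r addr0. Qed.

End Shadows.

Theorem theorem4p8 (R : realType) (n l : nat) (hl : (2 <= l)%N)
    (kappa : histogram l) (kappa_gt0 : forall i, (0 < kappa i)%N)
    (kappa_sum : (\sum_(i < l) kappa i)%N = n)
    (A : {set coloring n l}) (hA : A \subset multislice n kappa) :
  [/\ forall u : coloring n l, u \in multislice n kappa ->
        shadow_bound R kappa A <=
          E_lower u kappa (fun kappa' => vol R kappa' (lower_shadow kappa' A)),
      exists kappa' : histogram l, lower_neighbor kappa kappa' /\
        shadow_bound R kappa A <= vol R kappa' (lower_shadow kappa' A),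
      forall u : coloring n l, u \in multislice n kappa ->
        shadow_bound R kappa A <=
          E_upper u kappa (fun kappa' => vol R kappa' (upper_shadow kappa' A))
    & exists kappa' : histogram l, upper_neighbor kappa kappa' /\
        shadow_bound R kappa A <= vol R kappa' (upper_shadow kappa' A)].
Proof.
have lower_ex c d : (c < d)%O -> lower_neighbor kappa (recolor kappa d c).
  by move=> cd; exists c, d; split=> //; apply: one_step_recolor; rewrite ?lt_eqF.
have upper_ex c d : (c < d)%O -> upper_neighbor kappa (recolor kappa c d).
  by move=> cd; exists d, c; split=> //; apply: one_step_recolor; rewrite ?gt_eqF.
have lowerE u := shadow_bound_E_lower R hl kappa_gt0 kappa_sum hA (u := u).
have upperE u := shadow_bound_E_upper R hl kappa_gt0 kappa_sum hA (u := u).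
(* For empty [A] the bound is [0], and the neighbor given by the first two colors will do. Otherwise
   an element of [A] serves for the sampling, and some sampled pair reaches the mean. *)
have [A0|[u uA]] := set_0Vmem A.
  have c01 : (Ordinal (ltnW hl) < Ordinal hl)%O by [].
  split=> //.
  - exists (recolor kappa (Ordinal hl) (Ordinal (ltnW hl))); split; first exact: lower_ex.
    by rewrite A0 shadow_bound_set0 divr_ge0.
  - exists (recolor kappa (Ordinal (ltnW hl)) (Ordinal hl)); split; first exact: upper_ex.
    by rewrite A0 shadow_bound_set0 divr_ge0.
have uU := subsetP hA _ uA; have bi := bichromatic_neq0 hl kappa_gt0 uU.
have min_max (p : 'I_n * 'I_n) : p \in bichromatic u ->
    (Order.min (u p.1) (u p.2) < Order.max (u p.1) (u p.2))%O.
  rewrite inE neq_lt => /orP[] h; [rewrite min_l ?max_r | rewrite min_r ?max_l] => //; exact: ltW.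
split=> //.
- have [p /min_max pB pb] := mean_le_exists bi (lowerE u uU).
  by eexists; split; last exact: pb; apply: lower_ex.
- have [p /min_max pB pb] := mean_le_exists bi (upperE u uU).
  by eexists; split; last exact: pb; apply: upper_ex.
Qed.
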